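(* Let $(X,d,A)$ be a metric pair with $A$ not isolated and let $p\in[1,\infty]$. Then $(D(X,A),W_p)$ and $(\overline{D}_p(X,A),W_p)$ are not hemicompact.
   Context: A metric on $X$ is a map $d:X\times X\to[0,\infty]$ with $d(x,x)=0$, symmetry and the triangle inequality (infinite distances allowed, $d(x,y)=0$ need not imply $x=y$); a metric pair $(X,d,A)$ is such a space with a closed subset $A$. Write $d(x,A)=\inf_{a\in A}d(x,a)$, $A^\delta=\{x:d(x,A)<\delta\}$ for $\delta\in(0,\infty]$; $A$ is isolated if $A^\delta=A$ for some $\delta>0$. $\overline{D}(X,A)$ is the set of countable formal sums $\hat\alpha=\sum_{i\in I}x_i$ of points of $X\setminus A$ (repetitions allowed); $D(X,A)$ the finite ones; $0$ the empty sum. A matching of $\hat\alpha=\sum_{i\in I}x_i$, $\hat\beta=\sum_{j\in J}y_j$ is a formal sum $\sum_{k\in K}(x_k,y_{\varphi(k)})+\sum_{i\in I\setminus K}(x_i,z_i)+\sum_{j\in J\setminus\varphi(K)}(w_j,y_j)$ with $K\subset I$, $\varphi$ injective, $z_i,w_j\in A$; its $p$-cost is the $\ell^p$ norm (sup norm if $p=\infty$) of the distances of paired points; $W_p$ is the infimum of $p$-costs. $u_\delta(\alpha)$, $\ell_\delta(\alpha)$ are the restrictions of $\hat\alpha$ to $X\setminus A^\delta$ and to $A^\delta\setminus A$. For $p<\infty$, $\overline{D}_p(X,A)=\{\alpha: |u_\infty(\alpha)|<\infty,\ W_p(\ell_\infty(\alpha),0)<\infty\}$; $\overline{D}_\infty(X,A)=\{\alpha:|u_\delta(\alpha)|<\infty\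 \forall\delta>0\}$. A topological space is hemicompact if it has a sequence of compact subsets $K_1,K_2,\dots$ such that every compact subset of the space is contained in some $K_n$. *)

(* Defs.v *)
From HB Require Import structures.
From mathcomp Require Import all_boot all_order all_algebra.
From mathcomp Require Import all_classical all_reals.
From mathcomp Require Import ereal esum exp.
Set Implicit Arguments. Unset Strict Implicit. Unset Printing Implicit Defensive.
Import Order.TTheory GRing.Theory Num.Theory.
Local Open Scope classical_set_scope.
Local Open Scope ereal_scope.

Section Generic.
Variables (R : realType) (T : Type) (dist : T -> T -> \bar R).

Definition mball (x : T) (r : R) : set T := [set y | dist x y < r%:E].
Definition mopen (U : set T) : Prop :=
  forall x, U x -> exists r : R, (0 < r)%R /\ mball x r `<=` U.
Definition mclosed (F : set T) : Prop := mopen (~` F).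
Definition mcompact (K : set T) : Prop :=
  forall C : set (set T), (forall U, C U -> mopen U) ->
    K `<=` \bigcup_(U in C) U ->
    exists2 F : set (set T), finite_set F /\ F `<=` C & K `<=` \bigcup_(U in F) U.
(** Hemicompactness of the subspace S (with the restricted distance). Compact
   subsets of the subspace S are exactly the compact subsets of T contained in S. *)
Definition hemicompact (S : set T) : Prop :=
  exists Kn : nat -> set T,
    (forall n, Kn n `<=` S /\ mcompact (Kn n)) /\
    (forall K, K `<=` S -> mcompact K -> exists n, K `<=` Kn n).
End Generic.

Section Diagrams.
Variables (R : realType) (X : Type) (d : X -> X -> \bar R) (A : set X).

Definition is_metric : Prop :=
  (forall x y, 0 <= d x y) /\ (forall x, d x x = 0) /\
  (forall x y, d x y = d y x) /\ (forall x y z, d x z <= d x y + d y z).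

Definition distA (x : X) : \bar R := ereal_inf [set d x a | a in A].
Definition Anbhd (delta : R) : set X := [set x | distA x < delta%:E].
Definition isolated_set : Prop := exists delta : R, (0 < delta)%R /\ Anbhd delta = A.

(** A countable formal sum of points of X \ A (repetitions allowed): the points
    are indexed by the set of those i : nat with [dpt i = Some x]; every countable
    index set can be re-indexed into nat. *)
Record dgm := Dgm {
  dpt : nat -> option X;
  dpt_out : forall i x, dpt i = Some x -> ~ A x }.

Definition ddom (a : dgm) : set nat := [set i | dpt a i <> None].

Definition dgm0 : dgm := @Dgm (fun _ => None) (fun i x (h : None = Some x) =>
  match h in _ = o return (if o is Some _ then ~ A x else True) with
  | erefl => I end).

Definition drestrict_fun (a : dgm) (P : set X) : nat -> option X :=
  fun i => match dpt a i with
           | Some x => if `[< P x >] then Some x else None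
           | None => None end.
Lemma drestrict_out (a : dgm) (P : set X) i x :
  drestrict_fun a P i = Some x -> ~ A x.
Proof.
rewrite /drestrict_fun; case E: (dpt a i) => [y|] //.
case: `[< P y >] => // -[<-]; exact: (dpt_out E).
Qed.
Definition drestrict (a : dgm) (P : set X) : dgm := Dgm (@drestrict_out a P).

(** distance between two optional points (only used on defined ones) *)
Definition optd (o1 o2 : option X) : \bar R :=
  match o1, o2 with Some x, Some y => d x y | _, _ => 0 end.

Definition is_matching (a b : dgm) (K : set nat) (phi : nat -> nat)
    (z w : nat -> option X) : Prop :=
  [/\ K `<=` ddom a,
      (forall k, K k -> ddom b (phi k)),
      {in K &, injective phi},
      (forall i, (ddom a `\` K) i -> exists2 x, z i = Some x & A x) &
      (forall j, (ddom b `\` phi @` K) j -> exists2 x, w j = Some x & A x)].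

Definition match_cost (p : \bar R) (a b : dgm) (K : set nat) (phi : nat -> nat)
    (z w : nat -> option X) : \bar R :=
  let c1 := fun k => optd (dpt a k) (dpt b (phi k)) in
  let c2 := fun i => optd (dpt a i) (z i) in
  let c3 := fun j => optd (w j) (dpt b j) in
  match p with
  | r%:E => (esum K (fun k => c1 k `^ r) +
             esum (ddom a `\` K) (fun i => c2 i `^ r) +
             esum (ddom b `\` phi @` K) (fun j => c3 j `^ r)) `^ (r^-1)
  | +oo => ereal_sup ([set 0] `|` (c1 @` K) `|` (c2 @` (ddom a `\` K))
                       `|` (c3 @` (ddom b `\` phi @` K)))
  | -oo => +oo (* not used: p >= 1 *)
  end.

Definition Wp (p : \bar R) (a b : dgm) : \bar R :=
  ereal_inf [set c | exists K phi z w,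
     is_matching a b K phi z w /\ c = match_cost p a b K phi z w].

Definition Dfin : set dgm := [set a | finite_set (ddom a)].

Definition u_idx (a : dgm) (delta : \bar R) : set nat :=
  [set i | exists2 x, dpt a i = Some x & ~ (distA x < delta)].

Definition Dbar (p : \bar R) : set dgm :=
  match p with
  | +oo => [set a | forall delta : R, (0 < delta)%R ->
              finite_set (u_idx a delta%:E)]
  | _ => [set a | finite_set (u_idx a +oo) /\
            Wp p (drestrict a [set x | distA x < +oo]) dgm0 < +oo]
  end.
End Diagrams.

Arguments Dfin {X} A.
Arguments Wp {R X} d A p a b.
Arguments Dbar {R X} d A p.
Arguments dgm0 {X A}.

(* Main.v *)
(** A hemicompact space in which a point o has the countable base of balls
    B(o, 1/n) must have a compact neighbourhood of o: otherwise pick beta_n in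
    B(o, 1/n) \ K_n, and {o} together with the beta_n is compact but lies in no
    K_n. So it suffices to find, in every ball around the empty diagram, a
    sequence alpha_n and an increasing open cover U_n with alpha_n not in U_n.

    For p = oo take alpha_n = (n+1) x with x outside A close to A, and let U_n
    be the diagrams with at most n points at distance >= s from A, for some
    s < eps, where 0 < eps <= d(x, A). For p < oo take alpha_n = N_n x_n, with
    x_n approaching A and N_n chosen so that N_n d(x_n, A)^p stays of constant
    order, and let U_n be the diagrams whose weight sum_i min(d(x_i, A), 1/(n+1))^p
    is below a constant; for a fixed diagram of finite weight, this tends to 0.
    Openness of U_n is read off matchings, so neither the triangle inequality
    for W_p nor Minkowski's inequality is needed. *)
Require Import Defs.
From mathcomp Require Import all_boot all_order all_algebra.
From mathcomp Require Import all_classical all_reals.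
From mathcomp Require Import ereal esum exp.
From mathcomp Require Import lra.
Set Implicit Arguments. Unset Strict Implicit. Unset Printing Implicit Defensive.
Import Order.TTheory GRing.Theory Num.Theory.
Local Open Scope classical_set_scope.
Local Open Scope ereal_scope.

(** * Finite sets, sums over subsets of [nat], and powers *)

Lemma finite_nat_subset (F : set nat) :
  finite_set F -> exists n, F `<=` `I_n.
Proof.
move=> /finite_seqP[s ->]; exists (\max_(i <- s) i).+1 => i /= si.
by rewrite ltnS (leq_bigmax_seq _ si).
Qed.

Section Esum.
Variable R : realType.
Implicit Types (D E : set nat) (f : nat -> \bar R).

Lemma subset_esum D E f : D `<=` E -> (forall i, E i -> 0 <= f i) ->
  esum D f <= esum E f.
Proof.
move=> DE f0; rewrite [leRHS](esumID D)// (setIidr DE) leeDl//.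
by apply: esum_ge0 => i [/f0].
Qed.

Lemma esum_le_mul (c : R) D f : (0 <= c)%R -> (forall i, 0 <= f i) ->
  esum D (fun i => c%:E * f i) <= c%:E * esum D f.
Proof.
move=> c0 f0; apply: ge_ereal_sup => _ [F [finF FD] <-].
rewrite -ge0_mule_fsumr//; apply: lee_wpmul2l; first by rewrite lee_fin.
by apply: ereal_sup_ubound; exists F.
Qed.

Lemma esum_cst_II (e : R) n : (0 <= e)%R ->
  esum `I_n (fun=> e%:E) = (e *+ n)%:E.
Proof.
move=> e0; rewrite esum_fset// -fsbig_ord.
by rewrite sumEFin sumr_const card_ord.
Qed.

Lemma finite_esum_lty D f : finite_set D -> (forall i, 0 <= f i < +oo) ->
  esum D f < +oo.
Proof.
move=> finD f0; rewrite esum_fset//; last by move=> i _; have /andP[] := f0 i.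
rewrite fsbig_finite//=; apply: lte_sum_pinfty => i _.
by have /andP[] := f0 i.
Qed.

(** Some finite subsum comes within [e] of the total. Its index set lies below some [n], so the
    terms with index at least [n] add up to less than [e]. *)
Lemma esum_tail D f (e : R) : (forall i, 0 <= f i) -> esum D f < +oo ->
  (0 < e)%R -> exists n, esum (D `\` `I_n) f < e%:E.
Proof.
move=> f0 foo e0.
have fin : esum D f \is a fin_num by rewrite ge0_fin_numE// esum_ge0.
have [_ [F [finF FD] <-]] := ub_ereal_sup_adherent e0 fin.
have [n Fn] := finite_nat_subset finF.
rewrite -esum_fset// -/(esum D f) => H; exists n.
rewrite lteBlDr// in H.
have := esumID `I_n D f (fun i _ => f0 i).
rewrite -setDE => ED; rewrite {}ED in fin H.
have le1 : esum F f <= esum (D `&` `I_n) f.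
  by apply: subset_esum => // i Fi; split; [exact: FD|exact: Fn].
move: fin; rewrite fin_numD => /andP[f1 f2].
have := lt_le_trans H (leeD2r e%:E le1).
by rewrite lteD2lE.
Qed.

Lemma poweR_inv_lt (S : \bar R) (r eta : R) : (0 < r)%R -> 0 <= S ->
  S `^ r^-1 < eta%:E -> S < (eta `^ r)%:E.
Proof.
move=> r0 S0 Seta.
have r'0 : r^-1%R != 0%R by rewrite invr_eq0 gt_eqF.
have : S < +oo by apply: (lty_poweRy r'0); exact: lt_trans Seta (ltry _).
case: S S0 Seta => // s; rewrite lee_fin poweR_EFin !lte_fin => s0 seta _.
have /(gt0_ltr_powR r0) := seta; rewrite -powRrM mulVf ?gt_eqF// powRr1//.
by apply; rewrite nnegrE ?powR_ge0// (le_trans _ (ltW seta))// powR_ge0.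
Qed.

(* Either [c <= delta a], so that [b <= (1 + delta) a], or [a < c / delta],
   so that [b <= (1 + 1 / delta) c]. *)
Lemma powR_split (r kappa delta a b : R) (c : \bar R) :
  (0 < r)%R -> (0 < kappa)%R -> (0 < delta)%R -> (0 <= a)%R -> (0 <= b)%R ->
  0 <= c -> b%:E <= a%:E + c ->
  ((kappa * b) `^ r)%:E <= ((kappa * (1 + delta) * a) `^ r)%:E +
     ((kappa * (1 + delta^-1)) `^ r)%:E * c `^ r.
Proof.
move=> r0 k0 d0 a0 b0; have d'0 : (0 < delta^-1)%R by rewrite invr_gt0.
have C0 : (0 < (kappa * (1 + delta^-1)) `^ r)%R.
  by rewrite powR_gt0// mulr_gt0// addr_gt0.
case: c => // [c|_ _].
  rewrite !lee_fin => c0 bac; have K0 : (0 <= kappa * (1 + delta^-1))%R.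
    by rewrite mulr_ge0 ?addr_ge0// ltW.
  have K'0 : (0 <= kappa * (1 + delta))%R by rewrite mulr_ge0 ?addr_ge0// ltW.
  rewrite -powRM//.
  have [cd|cd] := leP c (delta * a)%R.
    apply: (@le_trans _ _ ((kappa * (1 + delta) * a) `^ r)%R).
      rewrite ge0_ler_powR ?nnegrE ?(ltW r0) ?mulr_ge0 ?(ltW k0) ?addr_ge0 ?(ltW d0)
        ?(ltW d'0)//.
      by rewrite -mulrA ler_pM2l//; lra.
    by rewrite lerDl powR_ge0.
  apply: (@le_trans _ _ ((kappa * (1 + delta^-1) * c) `^ r)%R).
    rewrite ge0_ler_powR ?nnegrE ?(ltW r0) ?mulr_ge0 ?(ltW k0) ?addr_ge0 ?(ltW d0)
        ?(ltW d'0)//.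
    rewrite -mulrA ler_pM2l// (le_trans bac)// mulrDl mul1r addrC lerD2l.
    by rewrite -(ler_pM2l d0) mulrA divff ?gt_eqF// mul1r ltW.
  by rewrite lerDr powR_ge0.
(* For [c = +oo] the right-hand side is infinite, its coefficient being positive. *)
by rewrite poweRyr ?gt_eqF// gt0_muley ?lte_fin// addey ?leey.
Qed.

End Esum.

(** * Compact sets and hemicompactness *)

Lemma not_hemicompact (R : realType) (T : Type) (dist : T -> T -> \bar R)
    (S : set T) (o : T) : S o ->
  (forall rho : R, (0 < rho)%R -> exists (alpha : nat -> T) (U : nat -> set T),
    [/\ forall n, S (alpha n) /\ mball dist o rho (alpha n),
        forall n, mopen dist (U n),
        forall m n, (m <= n)%N -> U m `<=` U n,
        S `<=` \bigcup_n U n &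
        forall n, ~ U n (alpha n)]) ->
  ~ hemicompact dist S.
Proof.
move=> So ballS [Kn [KnS coverK]].
have /choice[beta betaP] : forall n, exists b,
    [/\ S b, mball dist o n.+1%:R^-1%R b & ~ Kn n b].
  move=> n; have [|alpha [U [aS Uo Und SU Ua]]] := ballS n.+1%:R^-1%R.
    by rewrite invr_gt0.
  (* Otherwise [Kn n] contains the whole sequence [alpha]; being compact, it is covered by finitely
     many of the increasing sets [U k], hence by a single [U m], which misses [alpha m]. *)
  apply: contrapT => noB; have {}noB k : Kn n (alpha k).
    by apply: contrapT => Kk; apply: noB; exists (alpha k); have [] := aS k.
  have [KnSn /(_ (range U))[]] := KnS n.
  - by move=> _ [k _ <-].
  - by move=> x /KnSn/SU[k _ Ukx]; exists (U k) => //; exists k.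
  move=> F [finF FU] KF.
  have /choice[j jP] : forall V, exists k, F V -> U k = V.
    move=> V; have [/FU[k _ <-]|nFV] := pselect (F V); first by exists k.
    by exists 0%N.
  have [m jm] := finite_nat_subset (finite_image j finF).
  have [V FV Va] := KF _ (noB m); apply: (Ua m).
  apply: (Und (j V)); last by rewrite jP.
  by apply/ltnW/jm; exists V.
(* Compactness of this set: a member of the cover containing [o] contains a ball around [o], hence
   all [beta n] with [n >= N]; the remaining [N] points take one member each. *)
have [|C Cop KC|n Kn_] := coverK ([set o] `|` range beta).
- by move=> _ [->//|[n _ <-]]; have [] := betaP n.
- have [|U CU Uo] := KC o; first by left.
  have [e [e0 eU]] := Cop _ CU _ Uo.
  have /choice[V VP] n : exists V, C V /\ V (beta n).
    by have [|V ? ?] := KC (beta n); [right; exists n|exists V].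
  have [N eN] : exists N, (N.+1%:R^-1 < e)%R.
    by have [N] := ltr_add_invr e0; rewrite add0r; exists N.
  exists ([set U] `|` V @` `I_N).
    split; last by move=> _ [->//|[n _ <-]]; have [] := VP n.
    by rewrite finite_setU; split => //; apply: finite_image; exact: finite_II.
  move=> _ [->|[n _ <-]]; first by exists U => //; left.
  have [nN|Nn] := ltnP n N.
    by exists (V n); [right; exists n|have [] := VP n].
  exists U; [by left|apply: eU]; have [_ + _] := betaP n.
  rewrite /mball/= => /lt_trans; apply; rewrite lte_fin (le_lt_trans _ eN)//.
  by rewrite lef_pV2 ?posrE ?ltr0n// ler_nat.
- by have [_ _] := betaP n; apply; apply: Kn_; right; exists n.
Qed.

(** * The distance to [A] *)

Section Diagrams.
Variables (R : realType) (X : Type) (d : X -> X -> \bar R) (A : set X).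
Hypothesis dm : is_metric d.
Implicit Types (a b : dgm A) (x y : X) (p : \bar R).

Let d_ge0 x y : 0 <= d x y. Proof. by have [] := dm. Qed.

Let dC x y : d x y = d y x. Proof. by have [_ [_ []]] := dm. Qed.

Lemma distA_ge0 x : 0 <= distA d A x.
Proof. by apply: le_ereal_inf_tmp => _ [y _ <-]. Qed.

Lemma distA_le x y : A y -> distA d A x <= d x y.
Proof. by move=> Ay; apply: ereal_inf_lbound; exists y. Qed.

Lemma distA_lip x y : distA d A y <= distA d A x + d x y.
Proof.
have [->|dfin] := eqVneq (d x y) +oo.
  by rewrite addey ?leey// gt_eqF// (lt_le_trans _ (distA_ge0 x)).
have dxy : d x y \is a fin_num by rewrite ge0_fin_numE// lt_neqAle dfin leey.
rewrite -leeBlDr//; apply: le_ereal_inf_tmp => _ [a Aa <-].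
rewrite leeBlDr// (le_trans (distA_le _ Aa))//.
by have [_ [_ [_ /(_ y x a)]]] := dm; rewrite (dC y x) addeC.
Qed.

Lemma distA_gt0 x : mclosed d A -> ~ A x -> 0 < distA d A x.
Proof.
move=> cA /cA[e [e0 eA]]; rewrite (@lt_le_trans _ _ e%:E) ?lte_fin//.
apply: le_ereal_inf_tmp => _ [a Aa <-]; rewrite leNgt; apply/negP => dxa.
exact: (eA a).
Qed.

(** Non-isolation yields [x] outside [A] with [distA d A x < delta / 2], and closedness makes this
    distance positive. A point [a] of [A] nearer to [x] than twice this distance then gives both
    bounds on [e]. *)
Lemma points_near_A (delta : R) : mclosed d A -> ~ isolated_set d A ->
  (0 < delta)%R -> exists (x a : X) (e : R),
    [/\ ~ A x, A a, d x a = e%:E, (0 < e < delta)%R &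
        (e / 2)%:E <= distA d A x].
Proof.
move=> cA nisoA delta0.
have [x Ax xA] : exists2 x, ~ A x & distA d A x < (delta / 2)%:E.
  apply: contrapT => nx; apply: nisoA; exists (delta / 2)%R.
  split; first by rewrite divr_gt0.
  apply/seteqP; split=> x /=.
    by move=> xA; apply: contrapT => Ax; apply: nx; exists x.
  move=> Ax; rewrite /Anbhd /= (le_lt_trans (distA_le x Ax))//.
  by have [_ [-> _]] := dm; rewrite lte_fin divr_gt0.
have x0 := distA_gt0 cA Ax.
case E : (distA d A x) xA x0 => [t| |]// xA t0.
rewrite !lte_fin in xA t0.
have /ereal_inf_lt[_ [a Aa <-]] : distA d A x < (t * 2)%:E.
  by rewrite E lte_fin; lra.
have := distA_le x Aa; rewrite E.
case F : (d x a) => [e| |]//; rewrite lte_fin lee_fin => te et.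
exists x, a, e; rewrite E lee_fin; split=> //; lra.
Qed.

(** * Truncated distance and weights *)

(** Truncation keeps the value real at points infinitely far from [A], preserves the Lipschitz
    bound, and makes each single weight vanish as [s] tends to 0. *)
Definition cap (s : R) x : R := fine (mine (distA d A x) s%:E).

Lemma capE s x : (cap s x)%:E = mine (distA d A x) s%:E.
Proof.
rewrite /cap fineK//; have := distA_ge0 x.
by case: (distA d A x) => // t _; rewrite /mine; case: ifP.
Qed.

Lemma cap_ge0 s x : (0 <= s)%R -> (0 <= cap s x)%R.
Proof. by move=> s0; rewrite -lee_fin capE le_min distA_ge0 lee_fin. Qed.

Lemma cap_le s x : (cap s x <= s)%R.
Proof. by rewrite -lee_fin capE ge_min lexx orbT. Qed.

Lemma cap_le_distA s x : (cap s x)%:E <= distA d A x.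
Proof. by rewrite capE ge_min lexx. Qed.

Lemma cap_lip s x y : (cap s y)%:E <= (cap s x)%:E + d x y.
Proof.
rewrite !capE; have [h|h] := leP (distA d A x) s%:E.
  by rewrite ge_min distA_lip.
by rewrite ge_min leeDl ?orbT.
Qed.

Lemma le_cap s t x : (s <= t)%R -> (cap s x <= cap t x)%R.
Proof.
move=> st; rewrite -lee_fin !capE le_min !ge_min lexx/= lee_fin.
by rewrite st orbT.
Qed.

Definition wgt (r kappa s : R) a (i : nat) : \bar R :=
  oapp (fun x => ((kappa * cap s x) `^ r)%:E) 0 (dpt a i).

Lemma wgt_ge0 r kappa s a i : 0 <= wgt r kappa s a i.
Proof. by rewrite /wgt; case: dpt => //= x; rewrite lee_fin powR_ge0. Qed.

Lemma wgt_lty r kappa s a i : wgt r kappa s a i < +oo.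
Proof. by rewrite /wgt; case: dpt => //= x; rewrite ltry. Qed.

Lemma le_wgt r kappa kappa' s s' a i : (0 <= r)%R ->
  (0 <= kappa <= kappa')%R -> (0 <= s <= s')%R ->
  wgt r kappa s a i <= wgt r kappa' s' a i.
Proof.
move=> r0 /andP[k0 kk'] /andP[s0 ss']; rewrite /wgt; case: dpt => //= x.
have s'0 := le_trans s0 ss'; have k'0 := le_trans k0 kk'.
by rewrite lee_fin ge0_ler_powR ?nnegrE ?mulr_ge0 ?cap_ge0// ler_pM ?cap_ge0//
  le_cap.
Qed.

Lemma wgt_le r kappa s a i : (0 <= r)%R -> (0 <= kappa)%R -> (0 <= s)%R ->
  wgt r kappa s a i <= ((kappa * s) `^ r)%:E.
Proof.
move=> r0 k0 s0; rewrite /wgt; case: dpt => /= [x|]; last first.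
  by rewrite lee_fin powR_ge0.
by rewrite lee_fin ge0_ler_powR ?nnegrE ?mulr_ge0 ?cap_ge0// ler_wpM2l//
  cap_le.
Qed.

Lemma wgtM r kappa s a i : (0 <= kappa)%R -> (0 <= s)%R ->
  wgt r kappa s a i = (kappa `^ r)%:E * wgt r 1 s a i.
Proof.
move=> k0 s0; rewrite /wgt; case: dpt => /= [x|]; last by rewrite mule0.
by rewrite mul1r powRM ?cap_ge0.
Qed.

(** * Weights along matchings, and the open sets of small weight *)

Lemma Wp_lt p a b (eta : R) : Wp d A p a b < eta%:E ->
  exists K phi z w, is_matching a b K phi z w /\
    match_cost d p a b K phi z w < eta%:E.
Proof.
move=> /ereal_inf_lt[_ [K [phi [z [w [M ->]]]]] c].
by exists K, phi, z, w.
Qed.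

Lemma optd_ge0 u v : 0 <= optd d u v.
Proof. by case: u => // x; case: v => //= y. Qed.

Lemma ddomP a i : ddom a i -> exists x, dpt a i = Some x.
Proof. by rewrite /ddom /=; case: dpt => // x _; exists x. Qed.

(** A point of [b] is paired either with a point of [a], and [cap] is 1-Lipschitz, or with a point
    of [A], and the pairing distance bounds [cap]. Applying [powR_split] termwise gives the estimate
    for the sums. *)
Lemma esum_wgt_lip (r kappa delta s : R) a b K phi z w :
  (0 < r)%R -> (0 < kappa)%R -> (0 < delta)%R -> (0 <= s)%R ->
  is_matching a b K phi z w ->
  esum (ddom b) (wgt r kappa s b) <=
    esum (ddom a) (wgt r (kappa * (1 + delta)) s a) +
    ((kappa * (1 + delta^-1)) `^ r)%:E *
      (esum K (fun k => optd d (dpt a k) (dpt b (phi k)) `^ r) +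
       esum (ddom b `\` phi @` K) (fun j => optd d (w j) (dpt b j) `^ r)).
Proof.
move=> r0 k0 d0 s0 [KA Kphi inj _ wA].
set C := (_ `^ r)%R.
have C0 : (0 <= C)%R by rewrite powR_ge0.
set c1 := fun k : nat => _; set c3 := fun j : nat => _.
have c10 i : 0 <= c1 i by exact: poweR_ge0.
have c30 i : 0 <= c3 i by exact: poweR_ge0.
rewrite (esumID (phi @` K))//; last by move=> *; exact: wgt_ge0.
rewrite -setDE ge0_muleDr; [|by apply: esum_ge0 => *; exact: c10
                            |by apply: esum_ge0 => *; exact: c30].
rewrite addeA; apply: leeD.
  rewrite setIidr; last by move=> _ [k Kk <-]; exact: Kphi.
  (* Injectivity of [phi] on [K] lets the matched points of [b] be indexed by [K]. *)
  rewrite esum_image//.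
  apply: (@le_trans _ _ (esum K (fun k =>
      wgt r (kappa * (1 + delta)) s a k + C%:E * c1 k))).
    apply: le_esum => k Kk; rewrite /wgt /c1.
    have [x ->] := ddomP (KA _ Kk); have [y ->] := ddomP (Kphi _ Kk).
    by apply: powR_split; rewrite ?cap_ge0 ?optd_ge0 ?cap_lip.
  rewrite esumD//; last 2 first.
  - by move=> *; exact: wgt_ge0.
  - by move=> *; rewrite mule_ge0// lee_fin.
  apply: leeD; last exact: esum_le_mul.
  by apply: subset_esum => // *; exact: wgt_ge0.
apply: (le_trans _ (esum_le_mul _ C0 c30)); apply: le_esum => j Dj.
have [x wx Ax] := wA _ Dj; have [y bj] := ddomP Dj.1.
rewrite /wgt /c3 wx bj /=.
have := @powR_split _ r kappa delta 0 (cap s y) (d x y) r0 k0 d0.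
rewrite mulr0 powR0 ?gt_eqF// !add0e; apply=> //; first exact: cap_ge0.
by rewrite (le_trans (cap_le_distA _ _))// dC distA_le.
Qed.

(* The slack [kappa > 1] absorbs the factor [1 + delta] lost in
   [esum_wgt_lip], which makes the set open. *)
Definition small_weight (r s c : R) : set (dgm A) :=
  [set a | exists2 kappa : R, (1 < kappa)%R &
     esum (ddom a) (wgt r kappa s a) < c%:E].

Lemma small_weight_open (r s c : R) : (0 < r)%R -> (0 <= s)%R ->
  mopen (Wp d A r%:E) (small_weight r s c).
Proof.
move=> r0 s0 a [kappa k1 ac].
(* Since [1 + delta] is the midpoint of 1 and [kappa], the new slack [kappa'] is still above 1. *)
pose delta := ((kappa - 1) / 2)%R; pose kappa' := (kappa / (1 + delta))%R.
have d0 : (0 < delta)%R by rewrite /delta; lra.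
have k'E : (kappa' * (1 + delta) = kappa)%R.
  by rewrite /kappa' divfK// gt_eqF// addr_gt0.
have k'1 : (1 < kappa')%R.
  by rewrite /kappa' ltr_pdivlMr ?addr_gt0// mul1r /delta; lra.
have k'0 : (0 < kappa')%R by exact: lt_trans k'1.
pose C := ((kappa' * (1 + delta^-1)) `^ r)%R.
have C0 : (0 < C)%R by rewrite powR_gt0// mulr_gt0// addr_gt0// invr_gt0.
have gfin : esum (ddom a) (wgt r kappa s a) \is a fin_num.
  rewrite ge0_fin_numE ?esum_ge0//; last by move=> *; exact: wgt_ge0.
  exact: lt_trans ac (ltry _).
case E : (esum _ _) gfin ac => [g| |]// _; rewrite lte_fin => gc.
(* With this radius, [C] times the [r]-th power of the cost stays below the available gap
   [c - g]. *)
exists (((c - g) / C) `^ r^-1)%R; split.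
  by rewrite powR_gt0// divr_gt0// subr_gt0.
move=> b /Wp_lt[K [phi [z [w [M]]]]] /=.
set E1 := esum K _; set E2 := esum _ _; set E3 := esum _ _.
have E10 : 0 <= E1 by apply: esum_ge0 => *; exact: poweR_ge0.
have E20 : 0 <= E2 by apply: esum_ge0 => *; exact: poweR_ge0.
have E30 : 0 <= E3 by apply: esum_ge0 => *; exact: poweR_ge0.
move=> /(poweR_inv_lt r0); rewrite !adde_ge0// => /(_ isT).
rewrite -powRrM mulVf ?gt_eqF// powRr1 ?divr_ge0 ?(ltW C0) ?subr_ge0 ?(ltW gc)//.
move=> lt; exists kappa' => //.
apply: le_lt_trans (esum_wgt_lip r0 k'0 d0 s0 M) _.
rewrite k'E E -/E1 -/E3 -/C.
have {lt} : E1 + E3 < ((c - g) / C)%:E.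
  by apply: le_lt_trans lt; rewrite addeAC leeDl.
case: (E1 + E3) (adde_ge0 E10 E30) => // t _; rewrite lte_fin.
by rewrite ltr_pdivlMr// -EFinM -EFinD lte_fin mulrC; lra.
Qed.

Lemma small_weight_mono (r s s' c : R) : (0 <= r)%R -> (0 <= s <= s')%R ->
  small_weight r s' c `<=` small_weight r s c.
Proof.
move=> r0 ss' a [kappa k1 ac]; exists kappa; first exact: k1.
apply: le_lt_trans ac.
apply: le_esum => i _; apply: le_wgt => //.
by rewrite lexx (le_trans ler01 (ltW k1)).
Qed.

(** With slack [kappa = 2], the tail beyond some [N] is below [c / 2] at truncation level 1, hence
    at every smaller level; the first [N] terms are each at most [(2 * s) ^ r], which a small [s]
    controls. *)
Lemma small_weight_cover (r c : R) a : (1 <= r)%R -> (0 < c)%R ->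
  esum (ddom a) (wgt r 1 1 a) < +oo ->
  exists n, small_weight r n.+1%:R^-1 c a.
Proof.
move=> r1 c0 aoo; have r0 : (0 <= r)%R by exact: le_trans r1.
have w0 kappa s := wgt_ge0 r kappa s a.
have a2oo : esum (ddom a) (wgt r 2 1 a) < +oo.
  apply: (@le_lt_trans _ _ ((2 `^ r)%:E * esum (ddom a) (wgt r 1 1 a))).
    apply: le_trans (esum_le_mul _ (powR_ge0 _ _) (w0 _ _)).
    by apply: le_esum => i _; rewrite -wgtM ?lexx ?ler0n.
  by rewrite lte_mul_pinfty ?lee_fin ?powR_ge0.
have c20 : (0 < c / 2)%R by rewrite divr_gt0.
have [N tailN] := esum_tail (w0 2 1)%R a2oo c20.
(* The bound [1 / 2] gives [2 * s <= 1], so that [(2 * s) ^ r <= 2 * s]; the other makes [N] such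
   terms less than [c / 2]. Using [N.+1] avoids division by 0. *)
have [n nP] : exists n, (n.+1%:R^-1 < Num.min 2^-1 (c / 2 / (2 * N.+1%:R)) :> R)%R.
  have : (0 < Num.min 2^-1 (c / 2 / (2 * N.+1%:R)) :> R)%R.
    by rewrite lt_min invr_gt0 ltr0n/= divr_gt0// mulr_gt0.
  by move=> /ltr_add_invr[n]; rewrite add0r; exists n.
move: nP; rewrite lt_min => /andP[n2 nc].
set s := (n.+1%:R^-1)%R in n2 nc *.
have s0 : (0 < s)%R by rewrite invr_gt0.
have s1 : (s <= 1)%R by lra.
exists n, 2%R; first by lra.
rewrite (esumID `I_N); last by move=> i _; exact: w0.
rewrite -setDE.
have -> : c%:E = (c / 2)%:E + (c / 2)%:E by rewrite -EFinD -splitr.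
apply: lteD; last first.
  apply: le_lt_trans tailN; apply: le_esum => i _.
  by apply: le_wgt; rewrite ?lexx ?ler0n ?(ltW s0).
apply: (@le_lt_trans _ _ (esum `I_N (fun=> ((2 * s) `^ r)%:E))).
  apply: (@le_trans _ _ (esum `I_N (wgt r 2 s a))).
    by apply: subset_esum => [i []//|i _]; exact: w0.
  by apply: le_esum => i _; apply: wgt_le => //; exact: ltW.
rewrite esum_cst_II ?powR_ge0// lte_fin.
have : ((2 * s) `^ r <= 2 * s)%R by apply: ge1r_powR => //; lra.
move=> /(ler_wMn2r N) /le_lt_trans; apply.
move: nc; rewrite ltr_pdivlMr ?mulr_gt0// mulrA (mulrC s).
apply: le_lt_trans; rewrite -[leLHS]mulr_natr ler_pM2l ?mulr_gt0// ler_nat.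
exact: leqnSn.
Qed.

(** * Finiteness of the weight, and finite diagrams inside [Dbar] *)

Lemma weight_lty_Dfin r a : Dfin A a -> esum (ddom a) (wgt r 1 1 a) < +oo.
Proof.
by move=> /finite_esum_lty; apply=> i; rewrite wgt_ge0 wgt_lty.
Qed.

(** The finitely many points infinitely far from [A] have finite weight each. A matching of the
    others with the empty diagram sends them all to [A], so its cost dominates their weight. *)
Lemma weight_lty_Dbar r a : (0 < r)%R -> Dbar d A r%:E a ->
  esum (ddom a) (wgt r 1 1 a) < +oo.
Proof.
move=> r0 [ufin]; set b := drestrict _ _.
case/ereal_inf_lt => _ [K [phi [z [w [[_ Kphi _ zA _] ->]]]]] /=.
have K0 : K = set0 by apply/seteqP; split=> k // /Kphi.
rewrite K0 setD0 in zA *; rewrite esum_set0 add0e.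
set E2 := esum (ddom b) _; set E3 := esum _ _.
have E20 : 0 <= E2 by apply: esum_ge0 => *; exact: poweR_ge0.
have E30 : 0 <= E3 by apply: esum_ge0 => *; exact: poweR_ge0.
move=> /lty_poweRy; rewrite invr_eq0 gt_eqF// => /(_ isT) E23.
have {E23}E2oo : E2 < +oo by apply: le_lt_trans E23; rewrite leeDl.
have w0 := wgt_ge0 r 1 1 a.
rewrite (esumID (u_idx d a +oo)); last by move=> i _; exact: w0.
apply: lte_add_pinfty.
  apply: finite_esum_lty => [|i]; last by rewrite w0 wgt_lty.
  exact: finite_setIr.
apply: le_lt_trans E2oo; rewrite /E2.
have dom_b i x : dpt a i = Some x -> ~ u_idx d a +oo i -> dpt b i = Some x.
  move=> aix uai; rewrite /= /drestrict_fun aix asboolT//.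
  by apply: contrapT => xoo; apply: uai; exists x.
have sub : ddom a `&` ~` u_idx d a +oo `<=` ddom b.
  by move=> i [/ddomP[x aix] /(dom_b _ _ aix)]; rewrite /ddom /= => ->.
apply: le_trans (subset_esum sub _); last by move=> *; exact: poweR_ge0.
apply: le_esum => i iu; have [y zy Ay] := zA _ (sub _ iu).
have [/ddomP[x aix] /(dom_b _ _ aix) bix] := iu.
rewrite /b/= in bix; rewrite bix zy /wgt aix /= mul1r -poweR_EFin.
have cxy : (cap 1 x)%:E <= d x y.
  by rewrite (le_trans (cap_le_distA _ _))// distA_le.
rewrite gt0_ler_poweR ?(ltW r0)// in_itv/= leey andbT//.
by rewrite lee_fin cap_ge0.
Qed.

Lemma Dfin_Dbar p : 1 <= p -> Dfin A `<=` Dbar d A p.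
Proof.
have ufin a (delta : \bar R) : Dfin A a -> finite_set (u_idx d a delta).
  by apply: sub_finite_set => i [x aix _]; rewrite /ddom/= aix.
case: p => // [r r1 a fina|_ a fina delta _]; last exact: ufin.
split; first exact: ufin.
set b := drestrict _ _.
(* Every point kept by the restriction has a partner in [A] at finite distance; finitely many such
   pairings have finite cost. *)
have /choice[z zP] : forall i, exists oy, forall x, dpt b i = Some x ->
    exists y, [/\ oy = Some y, A y & d x y < +oo].
  move=> i; case E : (dpt b i) => [x|]; last by exists None.
  move: E; rewrite /= /drestrict_fun; case: dpt => // x'.
  case: asboolP => //= xoo -[x'x]; subst x'.
  have /ereal_inf_lt[_ [y Ay <-] dxy] := xoo.
  by exists (Some y) => _ [<-]; exists y.
apply: (@le_lt_trans _ _ (match_cost d r%:E b dgm0 set0 id z (fun=> None))).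
  apply: ereal_inf_lbound; exists set0, id, z, (fun=> None); split=> //.
  split=> //.
    by move=> i [/ddomP[x /zP[y [zy Ay _]]] _]; exists y.
  by move=> j [].
rewrite /= esum_set0 add0e image_set0 !setD0.
rewrite [X in _ + X](_ : _ = 0) ?adde0; last by apply: esum1 => i.
apply: poweR_lty; apply: finite_esum_lty => [|i].
  apply: sub_finite_set fina => i; rewrite /ddom/= /drestrict_fun.
  by case: dpt.
rewrite poweR_ge0 poweR_lty//; case E : (drestrict_fun _ _ _) => [x|]; last exact: ltry.
by have [y [-> _ /=]] := zP _ _ E.
Qed.

(** * Diagrams with a single repeated point *)

Lemma multiple_out x n : ~ A x ->
  forall i y, (if (i < n)%N then Some x else None) = Some y -> ~ A y.
Proof. by move=> Ax i y; case: ifP => // _ [<-]. Qed.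

Definition multiple x (Ax : ~ A x) (n : nat) : dgm A := Dgm (@multiple_out x n Ax).

Lemma ddom_multiple x (Ax : ~ A x) n : ddom (multiple Ax n) = `I_n.
Proof. by apply/seteqP; split=> i; rewrite /ddom/=; case: ifP. Qed.

Lemma Dfin_multiple x (Ax : ~ A x) n : Dfin A (multiple Ax n).
Proof. by rewrite /Dfin/= ddom_multiple; exact: finite_II. Qed.

Lemma Wp0_multiple_le p x (Ax : ~ A x) y n : A y ->
  Wp d A p dgm0 (multiple Ax n) <=
  match_cost d p dgm0 (multiple Ax n) set0 id (fun=> None) (fun=> Some y).
Proof.
move=> Ay; apply: ereal_inf_lbound; exists set0, id, (fun=> None), (fun=> Some y).
by split=> //; split=> // [i []//|j _]; exists y.
Qed.

Lemma Wp0_multiple_lt_fin (r e rho : R) x (Ax : ~ A x) y n :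
  (0 < r)%R -> (0 < e)%R -> (0 < rho)%R -> A y -> d x y = e%:E ->
  ((e `^ r) *+ n < rho `^ r)%R ->
  Wp d A r%:E dgm0 (multiple Ax n) < rho%:E.
Proof.
move=> r0 e0 rho0 Ay dxy lt.
apply: le_lt_trans (Wp0_multiple_le _ _ _ Ay) _ => /=.
rewrite esum_set0 add0e image_set0 !setD0.
rewrite [X in X + _](_ : _ = 0) ?add0e; last by apply: esum1 => i.
rewrite ddom_multiple (eq_esum (b := fun=> (e `^ r)%:E)); last first.
  by move=> i /= ->; rewrite dC dxy.
rewrite esum_cst_II ?powR_ge0// poweR_EFin lte_fin.
have -> : rho = ((rho `^ r) `^ r^-1)%R.
  by rewrite -powRrM divff ?gt_eqF// powRr1// ltW.
by rewrite gt0_ltr_powR ?invr_gt0// nnegrE ?powR_ge0// mulrn_wge0// powR_ge0.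
Qed.

(** In the sup norm repetition is free: sending every copy to [y] costs at most [e], whatever [n]
    is. *)
Lemma Wp0_multiple_lt_oo (e rho : R) x (Ax : ~ A x) y n :
  A y -> d x y = e%:E -> (0 < e < rho)%R ->
  Wp d A +oo dgm0 (multiple Ax n) < rho%:E.
Proof.
move=> Ay dxy /andP[e0 erho].
apply: le_lt_trans (Wp0_multiple_le _ _ _ Ay) _.
rewrite (@le_lt_trans _ _ e%:E) ?lte_fin//; apply: ge_ereal_sup.
move=> _ [[[->|[k //]]|[k []//]]|[j [+ _] <-]]; first by rewrite lee_fin ltW.
by rewrite ddom_multiple => /= ->; rewrite dC dxy.
Qed.

(** * The case of finite exponent *)

Lemma not_hemicompact_fin (r : R) (S : set (dgm A)) :
  mclosed d A -> ~ isolated_set d A -> (1 <= r)%R -> Dfin A `<=` S ->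
  (forall a, S a -> esum (ddom a) (wgt r 1 1 a) < +oo) ->
  ~ hemicompact (Wp d A r%:E) S.
Proof.
move=> cA nisoA r1 finS Soo; have r0 : (0 < r)%R by exact: lt_le_trans r1.
apply: (@not_hemicompact _ _ _ _ dgm0).
  by apply: finS; apply: sub_finite_set (finite_set0 _).
move=> rho rho0; pose q := (rho `^ r)%R.
have q0 : (0 < q)%R by exact: powR_gt0.
(* The sequence will have cost to the power [r] between [q / 2] and [q] when all copies go to [y];
   replacing [e] by the lower bound [e / 2] of the distance to [A] loses the factor [2^-1 ^ r]. *)
pose c := (q / 2 * 2^-1 `^ r)%R.
have c0 : (0 < c)%R by rewrite mulr_gt0// ?divr_gt0// powR_gt0// invr_gt0.
have /choice[alpha alphaP] : forall k, exists a, [/\ Dfin A a,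
    Wp d A r%:E dgm0 a < rho%:E & ~ small_weight r k.+1%:R^-1 c a].
  (* The first bound keeps the truncation level above [e / 2]; the second gives [e ^ r < q / 2]. *)
  move=> k; pose delta : R := Num.min k.+1%:R^-1%R ((q / 2) `^ r^-1)%R.
  have delta0 : (0 < delta)%R.
    by rewrite lt_min invr_gt0 ltr0n/= powR_gt0// divr_gt0.
  have [x [y [e [Ax Ay dxy /andP[e0]]]]] := points_near_A cA nisoA delta0.
  rewrite lt_min => /andP[ek eq] ex.
  have er0 : (0 < e `^ r)%R by exact: powR_gt0.
  have erq : (e `^ r < q / 2)%R.
    rewrite -[ltRHS](_ : ((q / 2) `^ r^-1) `^ r = _)%R; last first.
      by rewrite -powRrM mulVf ?gt_eqF// powRr1// ltW// divr_gt0.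
    by rewrite gt0_ltr_powR// nnegrE ?powR_ge0// ltW.
  (* By this choice [n.+1] copies satisfy [q / 2 < n.+1 * e ^ r <= q / 2 + e ^ r < q]. *)
  pose n := Num.truncn (q / 2 / e `^ r).
  have /andP[nq qn] : (n%:R <= q / 2 / e `^ r < n.+1%:R)%R.
    by apply: truncn_itv; rewrite !divr_ge0// ltW.
  rewrite ler_pdivlMr// in nq; rewrite ltr_pdivrMr// in qn.
  exists (multiple Ax n.+1); split; first exact: Dfin_multiple.
    apply: Wp0_multiple_lt_fin Ay dxy _ => //.
    rewrite -mulr_natl -addn1 natrD mulrDl mul1r -/q.
    by rewrite [ltRHS]splitr ler_ltD.
  case=> kappa k1; apply/negP; rewrite -leNgt ddom_multiple.
  apply: (@le_trans _ _ (esum `I_n.+1 (fun=> ((e / 2) `^ r)%:E))).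
    rewrite esum_cst_II ?powR_ge0// lee_fin powRM ?invr_ge0 ?(ltW e0)//.
    rewrite -mulrnAl -mulr_natl /c ler_wpM2r ?powR_ge0//.
    exact: ltW.
  apply: le_esum => i /= i_n; rewrite /wgt /= i_n /= lee_fin.
  have ecap : (e / 2 <= cap k.+1%:R^-1 x)%R.
    by rewrite -lee_fin capE le_min ex lee_fin (le_trans _ (ltW ek))//; lra.
  have cap0 := le_trans (ltW (divr_gt0 e0 (ltr0n _ 2))) ecap.
  have k0 : (0 <= kappa)%R by exact: le_trans (ltW k1).
  rewrite ge0_ler_powR ?(ltW r0) ?nnegrE ?mulr_ge0 ?invr_ge0 ?(ltW e0)//.
  by rewrite (le_trans ecap)// ler_peMl// ltW.
exists alpha, (fun k => small_weight r k.+1%:R^-1 c); split.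
- by move=> n; have [? ?] := alphaP n; split=> //; exact: finS.
- by move=> n; apply: small_weight_open; rewrite ?invr_ge0.
- move=> m n mn; apply: small_weight_mono; first exact: ltW.
  by rewrite invr_ge0 ler0n/= lef_pV2 ?posrE ?ltr0n// ler_nat.
- move=> a /Soo aoo; have [n] := small_weight_cover r1 c0 aoo.
  by exists n.
- by move=> n; have [] := alphaP n.
Qed.

(** * The case of infinite exponent *)

(* As above, the slack [s < eps] makes the set open. *)
Definition few_far (eps : R) (n : nat) : set (dgm A) :=
  [set a | exists2 s : R, (0 < s < eps)%R & exists2 l : seq nat, (size l <= n)%N &
     forall i x, dpt a i = Some x -> s%:E <= distA d A x -> i \in l].

(** In a matching of sup cost below [eta], a point of [b] at distance at least [s + eta] from [A]
    cannot be paired with [A], and its partner in [a] is at distance at least [s]. So [phi] maps the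
    list for [a] to one for [b], and [s + eta < eps]. *)
Lemma few_far_open eps n : mopen (Wp d A +oo) (few_far eps n).
Proof.
move=> a [s /andP[s0 seps] [l ln la]].
pose eta := ((eps - s) / 2)%R.
have eta0 : (0 < eta)%R by rewrite /eta; lra.
exists eta; split=> // b /Wp_lt[K [phi [z [w [[KA Kphi _ _ wA] cost]]]]].
have {cost} cost : forall t, ([set 0]
    `|` ((fun k => optd d (dpt a k) (dpt b (phi k))) @` K)
    `|` ((fun i => optd d (dpt a i) (z i)) @` (ddom a `\` K))
    `|` ((fun j => optd d (w j) (dpt b j)) @` (ddom b `\` phi @` K))) t ->
    t < eta%:E.
  by move=> t Ht; apply: le_lt_trans cost; exact: ereal_sup_ubound.
exists (s + eta)%R; first by rewrite /eta; lra.
exists (map phi l); first by rewrite size_map.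
move=> j y bj yA.
have [[k Kk kj]|nKj] := pselect ((phi @` K) j); last first.
  have Dj : (ddom b `\` phi @` K) j by split=> //; rewrite /ddom/= bj.
  have [x wj Ax] := wA _ Dj.
  have : d x y < eta%:E by apply: cost; right; exists j => //; rewrite wj bj.
  rewrite dC => /(le_lt_trans (distA_le _ Ax))/(le_lt_trans yA).
  by rewrite lte_fin; lra.
have [x ak] := ddomP (KA _ Kk).
have dxy : d x y < eta%:E.
  by apply: cost; left; left; right; exists k => //; rewrite ak kj bj.
rewrite -kj map_f// (la k x)// leNgt; apply/negP => xs.
have := le_lt_trans (le_trans yA (distA_lip x y)) (lteD xs dxy).
by rewrite -EFinD ltxx.
Qed.

Lemma not_hemicompact_oo (S : set (dgm A)) :
  mclosed d A -> ~ isolated_set d A -> Dfin A `<=` S -> S `<=` Dbar d A +oo ->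
  ~ hemicompact (Wp d A +oo) S.
Proof.
move=> cA nisoA finS SD; apply: (@not_hemicompact _ _ _ _ dgm0).
  by apply: finS; apply: sub_finite_set (finite_set0 _).
move=> rho rho0.
have [x [y [e [Ax Ay dxy /andP[e0 erho] ex]]]] := points_near_A cA nisoA rho0.
exists (fun n => multiple Ax n.+1), (few_far (e / 2)); split.
- move=> n; split; first by apply: finS; exact: Dfin_multiple.
  by apply: Wp0_multiple_lt_oo dxy _ => //; rewrite e0.
- by move=> n; exact: few_far_open.
- move=> m n mn a [s se [l lm la]]; exists s => //; exists l => //.
  exact: leq_trans mn.
(* Any positive threshold below [e / 2] serves as slack; [e / 4] is one. *)
- move=> a /SD/(_ _ (divr_gt0 e0 (ltr0n _ 4)))/finite_seqP[l lE].
  exists (size l) => //.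
  exists (e / 4)%R; first by lra.
  exists l => // i z ai zA; suff : u_idx d a (e / 4)%:E i by rewrite lE.
  by exists z => //; apply/negP; rewrite -leNgt.
- move=> n [s /andP[s0 se] [l ln la]].
  (* All [n.+1] copies are at distance at least [e / 2 > s], so their distinct indices would fit in
     a list of length at most [n]. *)
  have : (size (iota 0 n.+1) <= size l)%N.
    apply: uniq_leq_size; first exact: iota_uniq.
    move=> i; rewrite mem_iota add0n => /= i_n; apply: (la i x).
      by rewrite /= i_n.
    by rewrite (le_trans _ ex)// lee_fin ltW.
  by rewrite size_iota leqNgt ltnS ln.
Qed.

End Diagrams.

Theorem theorem7p21 (R : realType) (X : Type) (d : X -> X -> \bar R)
    (A : set X) (p : \bar R) :
  is_metric d -> mclosed d A -> ~ isolated_set d A -> 1 <= p ->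
  ~ hemicompact (Wp d A p) (Dfin A) /\ ~ hemicompact (Wp d A p) (Dbar d A p).
Proof.
move=> dm cA nisoA p1; have finD := @Dfin_Dbar _ _ d A p p1.
case: p p1 finD => // [r|_ finD]; last by split; exact: not_hemicompact_oo.
rewrite lee_fin => r1 finD; have r0 : (0 < r)%R by exact: lt_le_trans r1.
split; apply: not_hemicompact_fin => // a.
  exact: weight_lty_Dfin.
exact: weight_lty_Dbar.
Qed.
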